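(* Let $k\in\mathbb{N}$ and $\mathbf{k}=(k)$ (so that $l=1$), and let $Q^{\mathbf{k}}_n(x,y)$, $0\leqslant n\leqslant k+1$, be the polynomials such that $$E_{\mathbf{k}}(z,x,y)=E(z,x,y)\sum_{n=0}^{k+1} z^n Q^{\mathbf{k}}_n(x,y)\qquad\text{for all } |z|<1,\ x,y\in\mathbb{C}.$$ Then, for $0\leqslant n\leqslant k+1$, $$Q^{\mathbf{k}}_n(x,y)=\mathbf{1}_{\{n\geqslant 1\}}\,2^{n-1}(k)_{n-1}H_{k+1-n}(x)H_{k+1-n}(y)-2^{n+1}(k)_{n+1}H_{k-1-n}(x)H_{k-1-n}(y),$$ where $(r)_n:=r(r-1)\cdots(r-n+1)$ denotes the falling factorial.
   Context: $\mathbb{N}$ is the set of positive integers. $H_n(x)$ denotes the (physicists') Hermite polynomials, $H_n(x)=(-1)^n e^{x^2}\frac{d^n}{dx^n}e^{-x^2}$ for $n\geqslant 0$, and $H_n(x)\equiv 0$ for $n<0$. The first term on the right-hand side of the formula for $Q_n^{\mathbf{k}}$ is $0$ when $n=0$. For $\mathbf{k}=(k)$, $H_{\mathbf{k},n}(x):=\mathrm{Wr}[H_k(x),H_n(x)]=H_k(x)H_n'(x)-H_k'(x)H_n(x)$. For $|z|<1$ and $x,y\in\mathbb{C}$, $$E(z,x,y):=\sum_{n\geqslant 0} z^n\frac{H_n(x)H_n(y)}{2^n n!}=\frac{1}{\sqrt{1-z^2}}\exp\Big(\frac{2xyz-z^2(x^2+y^2)}{1-z^2}\Big)$$ (principal branch),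 and $$E_{\mathbf{k}}(z,x,y):=\sum_{n\geqslant 0,\ n\neq k} z^n\frac{H_{\mathbf{k},n}(x)H_{\mathbf{k},n}(y)}{2^{n+1}\,n!\,(n-k)};$$ the series converges for all $|z|<1$, $x,y\in\mathbb{C}$. Polynomials $Q^{\mathbf{k}}_n(x,y)$ with the stated property exist and are unique. *)

(* Defs.v *)
From HB Require Import structures.
From mathcomp Require Export all_boot all_order all_algebra.
From mathcomp Require Export complex.
From mathcomp Require Export all_classical all_reals all_analysis.
Export numFieldNormedType.Exports.
From mathcomp Require Import ring.
Import Order.TTheory GRing.Theory Num.Theory.

Set Implicit Arguments.
Unset Strict Implicit.
Unset Printing Implicit Defensive.

Local Open Scope classical_set_scope.
Local Open Scope ring_scope.
Local Open Scope complex_scope.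

Definition rodrigues (R : realType) (n : nat) (x : R) : R :=
  (-1) ^+ n * expR (x ^+ 2) * derive1n n (fun t : R => expR (- t ^+ 2)) x.

(* The polynomial coinciding with the Rodrigues expression on the real line;
   hermiteE and hermite_unique below show that it is well defined. *)
Definition hermite (R : realType) (n : nat) : {poly R} :=
  xget 0 [set p : {poly R} | forall x : R, p.[x] = rodrigues n x].

(* H_m for an arbitrary integer index, as a polynomial over C *)
Definition hermiteC (R : realType) (m : int) : {poly R[i]} :=
  match m with
  | Posz n => map_poly (real_complex R) (hermite R n)
  | Negz _ => 0
  end.

Definition wronskian (K : nzRingType) (p q : {poly K}) : {poly K} :=
  p * q^`() - p^`() * q.

(* The exceptional polynomial H_{(k),n} = Wr[H_k, H_n] of the one-part
   partition (k) *)
Definition hermiteX (R : realType) (k n : nat) : {poly R[i]} :=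
  wronskian (hermiteC R k) (hermiteC R n).

(* The sums E and E_(k) of the two series. Limits are taken in R[i]^o, which
   carries the topology of the complex modulus; limn is total, and both series
   converge for |z| < 1. *)
Definition mehler (R : realType) (z x y : R[i]) : R[i] :=
  limn (fun N : nat => \sum_(0 <= n < N)
    z ^+ n * ((hermiteC R n).[x] * (hermiteC R n).[y]
              / (2 ^+ n * n`!%:R)) : R[i]^o).

Definition mehlerX (R : realType) (k : nat) (z x y : R[i]) : R[i] :=
  limn (fun N : nat => \sum_(0 <= n < N | n != k)
    z ^+ n * ((hermiteX R k n).[x] * (hermiteX R k n).[y]
              / (2 ^+ n.+1 * n`!%:R * (n%:R - k%:R))) : R[i]^o).

Section WellDefined.
Variable R : realType.
Implicit Types (p : {poly R}) (n : nat) (x : R).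

Let w (t : R) : R := expR (- t ^+ 2).

Let is_derive_w x : is_derive x 1 w (- (x *+ 2) * w x).
Proof.
have -> : w = (fun t => expR (horner (- 'X^2) t)).
  by apply/funext => t; rewrite hornerN hornerXn.
apply: is_derive_eq.
by rewrite derivN derivXn !(hornerE, hornerMn) /= /w mulrC.
Qed.

Let derive1n_wS n p : (forall x, derive1n n w x = p.[x] * w x) ->
  forall x, derive1n n.+1 w x = (p^`() - 'X *+ 2 * p).[x] * w x.
Proof.
move=> IH x; rewrite derive1nS (_ : derive1n n w = horner p * w); last first.
  by apply/funext => t; rewrite IH.
rewrite derive1E; have := is_deriveM (is_derive_poly p x) (is_derive_w x).
move=> /@derive_val ->.
rewrite -[LHS]/(p.[x] * (- (x *+ 2) * w x) + w x * p^`().[x]).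
rewrite hornerD hornerN hornerM hornerMn hornerX.
move: (w x) p.[x] p^`().[x] => a b c; rewrite -mulr_natl; ring.
Qed.

Let derive1n_w n : exists p, forall x, derive1n n w x = p.[x] * w x.
Proof.
elim: n => [|n [p IH]]; last by eexists; exact: derive1n_wS IH.
by exists 1 => x; rewrite derive1n0 hornerE mul1r.
Qed.

Let poly_ext p q : (forall x, p.[x] = q.[x]) -> p = q.
Proof.
move=> pq; apply/eqP; rewrite -subr_eq0; apply/negPn/negP => pq0.
pose s : seq R := [seq i%:R | i <- iota 0 (size (p - q))].
have := @max_poly_roots _ _ s pq0; rewrite size_map size_iota ltnn => H.
suff: false by []; apply: H.
  by apply/allP => x _; rewrite /root !hornerE pq subrr.
rewrite map_inj_uniq ?iota_uniq// => i j /eqP.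
by rewrite eqr_nat => /eqP.
Qed.

Let rodriguesE n p : (forall x, derive1n n w x = p.[x] * w x) ->
  forall x, rodrigues n x = ((-1) ^+ n *: p).[x].
Proof.
move=> H x; rewrite /rodrigues -/w H hornerZ -!mulrA; congr (_ * _).
by rewrite mulrCA /w expRN mulfV ?mulr1// gt_eqF// expR_gt0.
Qed.

Lemma hermiteE n x : (hermite R n).[x] = rodrigues n x.
Proof.
have [p hp] := derive1n_w n; move: x.
apply: (@xgetPex _ 0 [set p | forall x, p.[x] = rodrigues n x]).
by exists ((-1) ^+ n *: p) => x; rewrite -rodriguesE.
Qed.

Lemma hermite_unique n p : (forall x, p.[x] = rodrigues n x) -> p = hermite R n.
Proof. by move=> hp; apply: poly_ext => x; rewrite hp hermiteE. Qed.

Lemma hermite0 : hermite R 0 = 1.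
Proof.
apply/esym/hermite_unique => x; rewrite (@rodriguesE 0 1) ?expr0 ?scale1r// => t.
by rewrite derive1n0 hornerE mul1r.
Qed.

Lemma hermiteS n :
  hermite R n.+1 = 'X *+ 2 * hermite R n - (hermite R n)^`().
Proof.
have [p hp] := derive1n_w n.
have -> : hermite R n = (-1) ^+ n *: p.
  by apply/esym/hermite_unique => x; rewrite (rodriguesE hp).
apply/esym/hermite_unique => x; rewrite (rodriguesE (derive1n_wS hp)) derivZ.
rewrite exprS !(hornerZ, hornerD, hornerN, hornerM, hornerMn, hornerX).
ring.
Qed.

End WellDefined.

(* Main.v *)
Require Import Defs.
From mathcomp Require Import ring lra.

(** Fix x and y, and let a_n = H_n(x) H_n(y) / (2^n n!) be the coefficient of
    z^n in E.  The factorials and powers of 2 in the claimed formula are exactly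
    those that turn it into
      q_j = 2^k k! (a_(k+1-j) - a_(k-1-j)),
    where a vanishes at negative indices and the first term is dropped for
    j = 0.  So the claim says that E_(k) = E * sum_j q_j z^j, that is, for
    every m, that the coefficient of z^m in E_(k) is sum_j a_(m-j) q_j.

    This coefficient identity is lemma [wronskian_conv].  Write T(k, m) for
    sum_j a_(m-j) q_j / (2^k k!).  Shifting both indices telescopes:
      T(k+1, m+1) = T(k, m) + a_m a_(k+1) - a_(m+1) a_k,
    which is [conv_quotientSS].  The product of Wronskians at x and at y
    satisfies the same recursion once the factor m - k, which the shift leaves
    unchanged, is cleared.  The reason is that the Wronskian of H_k and H_m has
    two expressions as a combination of products of two Hermite values: with
    H_n' = 2n H_(n-1) at level (k+1, m+1), and with H_n' = 2x H_n - H_(n+1) at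
    level (k, m); both involve the same two products H_(k+1) H_m and
    H_k H_(m+1).

    Uniqueness then identifies q with Q.  For small z the series E converges
    to a nonzero number, because |a_n| <= A^n for some A ([mehler_coef_growth],
    [cvg_geometric_bound]); the coefficient identity then writes the partial
    sums of E_(k) as finite combinations of delayed partial sums of E, so that
    E_(k) = E * sum_j q_j z^j ([mehler_factorization]).  Dividing by E, the
    polynomials in z with coefficients q_j and Q_j(x, y) agree near 0, hence
    are equal. *)
Import Order.TTheory GRing.Theory Num.Theory.

Set Implicit Arguments.
Unset Strict Implicit.
Unset Printing Implicit Defensive.

Local Open Scope ring_scope.

(** * Convolution with the coefficients of the quotient *)

Section Convolution.
Variable K : comNzRingType.
Implicit Types (a : nat -> K) (k m j : nat).

(** The coefficient of z^m in z^j * sum_n a_n z^n. *)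
Definition shifted a m j : K := if (j <= m)%N then a (m - j)%N else 0.

Lemma shiftedSS a m j : shifted a m.+1 j.+1 = shifted a m j.
Proof. by rewrite /shifted ltnS subSS. Qed.

Lemma shifted0 a m : shifted a m 0 = a m.
Proof. by rewrite /shifted subn0. Qed.

(** a_(k+1-j) - a_(k-1-j) without negative indices; a_(k+1-j) is dropped at
    j = 0. *)
Definition quotient_coef a k j : K :=
  (if j is i.+1 then shifted a k i else 0) - shifted a k j.+1.

Definition conv_quotient a k m : K :=
  \sum_(j < k.+2) shifted a m j * quotient_coef a k j.

Lemma quotient_coefSS a k j :
  quotient_coef a k.+1 j.+1 = quotient_coef a k j + (j == 0)%:R * a k.+1.
Proof.
rewrite /quotient_coef shiftedSS; case: j => [|j] /=.
  by rewrite shifted0 mul1r sub0r addrC.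
by rewrite shiftedSS mul0r addr0.
Qed.

(** The quotient coefficients at (k+1, j+1) and (k, j) differ only at j = 0, by
    the entry a_(k+1) that is dropped there, so the shifted convolution gains
    one product; the other one is the new term j = 0. *)
Lemma conv_quotientSS a k m :
  conv_quotient a k.+1 m.+1 =
  conv_quotient a k m + a m * a k.+1 - a m.+1 * a k.
Proof.
rewrite /conv_quotient big_ord_recl shifted0 /= {1}/quotient_coef shiftedSS.
rewrite shifted0 sub0r mulrN addrC; congr (_ - _).
under eq_bigr => j _ do rewrite /bump /= add1n shiftedSS quotient_coefSS mulrDr.
rewrite big_split /=; congr (_ + _).
rewrite big_ord_recl big1 ?addr0 ?shifted0 ?mul1r// => j _.
by rewrite /= mul0r mulr0.
Qed.

Lemma conv_quotient0r a k : conv_quotient a k 0 = - a 0 * shifted a k 1.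
Proof.
rewrite /conv_quotient big_ord_recl big1 ?addr0; last first.
  by move=> j _; rewrite /shifted/= mul0r.
by rewrite shifted0 /quotient_coef sub0r mulrN mulNr.
Qed.

Lemma conv_quotient0l a m : conv_quotient a 0 m = shifted a m 1 * a 0.
Proof.
rewrite /conv_quotient 2!big_ord_recl big_ord0 addr0 /quotient_coef /=.
by rewrite shifted0 ![shifted a 0 _.+1]/shifted !subr0 mulr0 add0r.
Qed.

Lemma conv_quotient_diag a k : conv_quotient a k k = 0.
Proof.
elim: k => [|k IH]; first by rewrite conv_quotient0l /shifted mul0r.
by rewrite conv_quotientSS IH add0r mulrC subrr.
Qed.
End Convolution.

Section CauchyProduct.
Variable K : comNzRingType.
Implicit Types (a q : nat -> K) (z : K).

(** A finite Cauchy product is a combination of delayed partial sums.  The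
    truncated subtraction makes the sum empty for N <= j, as it should be. *)
Lemma sum_shifted a q M z N :
  \sum_(0 <= n < N) z ^+ n * \sum_(j < M) shifted a n j * q j =
  \sum_(j < M) z ^+ j * q j * \sum_(0 <= n < N - j) z ^+ n * a n.
Proof.
elim: N => [|N IH].
  by rewrite big_nil big1// => j _; rewrite sub0n big_nil mulr0.
rewrite big_nat_recr//= IH mulr_sumr -big_split; apply: eq_bigr => j _ /=.
rewrite /shifted; case: leqP => [jN|Nj].
  rewrite subSn// big_nat_recr//= mulrDr; congr (_ + _).
  by rewrite -{1}(subnK jN) exprD; ring.
have /eqP-> : (N.+1 - j == 0)%N by rewrite subn_eq0.
have /eqP-> : (N - j == 0)%N by rewrite subn_eq0 ltnW.
by rewrite mul0r mulr0 addr0.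
Qed.

End CauchyProduct.

(** * The Wronskian identity *)

Section HermiteRecurrence.
Variable K : numFieldType.

(** The relations satisfied by the values at x of the Hermite polynomials (u)
    and of their derivatives (du). *)
Definition hermite_rec (x : K) (u du : nat -> K) :=
  [/\ u 0 = 1, du 0 = 0, forall n, u n.+1 = x *+ 2 * u n - du n
    & forall n, du n.+1 = n.+1%:R *+ 2 * u n].

Definition mehler_coef (u v : nat -> K) n := u n * v n / (2 ^+ n * n`!%:R).

(** Induction along (k, m) -> (k+1, m+1), which preserves m - k.  Let
    U = u_(k+1) u_m, V = u_k u_(m+1), M = m+1 and L = k+1.  The Wronskian is
    U - V at level (k, m) and 2 (M U - L V) at level (k+1, m+1).  With U', V'
    the same products for v, the cross terms cancel in
      (M U - L V) (M U' - L V') - M L (U - V) (U' - V')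
        = (M - L) (M U U' - L V V'),
    and the right-hand side is, up to normalisation, the increment given by
    [conv_quotientSS]. *)
Lemma wronskian_conv x y u du v dv k m :
  hermite_rec x u du -> hermite_rec y v dv ->
  (u k * du m - du k * u m) * (v k * dv m - dv k * v m) =
  (m%:R - k%:R) * (2 ^+ (m + k).+1 * m`!%:R * k`!%:R)
  * conv_quotient (mehler_coef u v) k m.
Proof.
move=> [u0 du0 uS duS] [v0 dv0 vS dvS].
have f0 n : n`!%:R != 0 :> K by rewrite pnatr_eq0 -lt0n fact_gt0.
have e0 n : 2 ^+ n != 0 :> K by rewrite expf_neq0// pnatr_eq0.
have s0 n : n.+1%:R != 0 :> K by rewrite pnatr_eq0.
elim: k m => [|k IH] [|m].
- by rewrite subrr !mul0r u0 du0 mulr0 !mul0r subr0 mul0r.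
- rewrite conv_quotient0l shiftedSS shifted0 u0 v0 du0 dv0 duS dvS.
  rewrite /mehler_coef u0 v0 !factS fact0 addn0 !exprS expr0 natrM.
  by field; rewrite f0 e0.
- rewrite conv_quotient0r shiftedSS shifted0 u0 v0 du0 dv0 duS dvS.
  rewrite /mehler_coef u0 v0 !factS fact0 add0n !exprS expr0 natrM.
  by field; rewrite f0 e0.
(* The derivatives are traded for values one index higher. *)
have wrE t w dw : (forall n, w n.+1 = t *+ 2 * w n - dw n :> K) ->
    w k * dw m - dw k * w m = w k.+1 * w m - w k * w m.+1.
  by move=> wS; rewrite !wS; ring.
have := IH m; rewrite (wrE _ _ _ uS) (wrE _ _ _ vS) => {}IH.
have aS n : mehler_coef u v n.+1 =
    u n.+1 * v n.+1 / (2 * n.+1%:R * (2 ^+ n * n`!%:R)).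
  by rewrite /mehler_coef factS natrM exprS; congr (_ / _); ring.
rewrite conv_quotientSS !duS !dvS !aS /mehler_coef.
have -> : 2 ^+ (m.+1 + k.+1).+1 * m.+1`!%:R * k.+1`!%:R =
    8 * m.+1%:R * k.+1%:R * (2 ^+ m * m`!%:R) * (2 ^+ k * k`!%:R) :> K.
  by rewrite !factS !natrM addSn addnS !exprS exprD; ring.
have mk : m%:R - k%:R = m.+1%:R - k.+1%:R :> K by rewrite -!natr1; ring.
move: IH; rewrite mk.
have -> : 2 ^+ (m + k).+1 * m`!%:R * k`!%:R =
    2 * (2 ^+ m * m`!%:R) * (2 ^+ k * k`!%:R) :> K.
  by rewrite exprS exprD; ring.
move: (mulf_neq0 (e0 m) (f0 m)) (mulf_neq0 (e0 k) (f0 k)) (s0 m) (s0 k).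
move: (2 ^+ m * _) (2 ^+ k * _) m.+1%:R k.+1%:R (conv_quotient _ _ _).
move: (u m) (u m.+1) (u k) (u k.+1) (v m) (v m.+1) (v k) (v k.+1).
move=> um um1 uk uk1 vm vm1 vk vk1 p q M L c p0 q0 M0 L0 IH.
have -> : (M - L) * (8 * M * L * p * q) *
    (c + um * vm / p * (uk1 * vk1 / (2 * L * q)) -
     um1 * vm1 / (2 * M * p) * (uk * vk / q)) =
  4 * M * L * ((M - L) * (2 * p * q) * c) +
    4 * (M - L) * (M * (um * vm * uk1 * vk1) - L * (um1 * vm1 * uk * vk)).
  by field; rewrite p0 q0 M0 L0.
by rewrite -IH; ring.
Qed.

End HermiteRecurrence.

(** * Hermite polynomials *)

Section HermitePolynomials.
Variable R : realType.

Lemma hermiteC0 : hermiteC R 0 = 1.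
Proof. by rewrite /= hermite0 rmorph1. Qed.

Lemma hermiteCS (n : nat) :
  hermiteC R n.+1 = 'X *+ 2 * hermiteC R n - (hermiteC R n)^`().
Proof.
by rewrite /= hermiteS rmorphB rmorphM rmorphMn /= map_polyX deriv_map.
Qed.

Lemma deriv_hermiteC (n : nat) :
  (hermiteC R n.+1)^`() = (n.+1%:R *+ 2) *: hermiteC R n.
Proof.
elim: n => [|n IH].
  by rewrite hermiteCS hermiteC0 mulr1 derivC subr0 derivMn derivX
             -mul_polyC polyCMn mulr1.
rewrite hermiteCS derivB derivM derivMn derivX IH derivZ -[n.+2%:R]natr1.
rewrite mulrnDl [in RHS]scalerDl {2}hermiteCS -!mul_polyC !polyCMn.
move: (hermiteC R n) (hermiteC R n.+1) (hermiteC R n)^`() => h h1 h'.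
ring.
Qed.

Lemma hermite_rec_hermiteC (x : R[i]) :
  hermite_rec x (fun n : nat => (hermiteC R n).[x])
                (fun n : nat => (hermiteC R n)^`().[x]).
Proof.
split=> [||n|n]; first by rewrite hermiteC0 hornerC.
- by rewrite hermiteC0 derivC horner0.
- by rewrite hermiteCS hornerD hornerN hornerM hornerMn hornerX.
- by rewrite deriv_hermiteC hornerZ.
Qed.

End HermitePolynomials.

(** * Growth of the coefficients *)

Section Growth.
Variable R : realType.
Local Open Scope complex_scope.

(** The normalisation by sqrt (2^n n!) turns the three-term recurrence into one
    with bounded coefficients; the estimate is stated for squares to avoid the
    root. *)
Lemma hermite_rec_growth (x : R[i]) u du (c A : R) n :
  hermite_rec x u du -> `|x| <= c%:C -> 4 * c ^+ 2 <= A -> 2 <= A ->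
  `|u n| ^+ 2 <= (A ^+ n * (2 ^+ n * n`!%:R))%:C.
Proof.
move=> [u0 du0 uS duS] xc cA A2.
(* The modulus as a real number, so that real arithmetic applies. *)
pose g n : R := complex.Re `|u n|.
have gE m : `|u m| = (g m)%:C by rewrite /g normc_def.
have g_ge0 m : 0 <= g m by rewrite -ler0c -gE normr_ge0.
have c_ge0 : 0 <= c by rewrite -ler0c (le_trans _ xc).
have g0 : g 0 = 1 by apply: complexI; rewrite -gE u0 normr1.
have gx m : `|x *+ 2 * u m| <= (c * 2 * g m)%:C.
  rewrite normrM !rmorphM /= -gE ler_wpM2r// normrMn -[leLHS]mulr_natr.
  by rewrite rmorph_nat ler_wpM2r.
have g1 : g 1 <= c * 2.
  by rewrite -lecR -gE uS du0 subr0 (le_trans (gx 0)) // g0 mulr1.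
have gSS m : g m.+2 <= c * 2 * g m.+1 + m.+1%:R * 2 * g m.
  rewrite -lecR -gE uS (le_trans (ler_normB _ _))// rmorphD lerD// duS normrM.
  by rewrite [in leRHS]rmorphM /= -gE -mulr_natr -!natrM normr_nat rmorph_nat.
rewrite gE -rmorphXn lecR.
suff: g n ^+ 2 <= A ^+ n * (2 ^+ n * n`!%:R) /\
      g n.+1 ^+ 2 <= A ^+ n.+1 * (2 ^+ n.+1 * n.+1`!%:R) by case.
elim: n => [|n [IH1 IH2]].
  rewrite g0 expr1n factS fact0 !expr0 !expr1 !mulr1; split=> //.
  have := g_ge0 1; nra.
split=> //.
set P := A ^+ n * (2 ^+ n * n`!%:R) in IH1.
have P0 : 0 <= P by rewrite /P !mulr_ge0 ?exprn_ge0//; lra.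
have m1 : 1 <= n.+1%:R :> R by rewrite ler1n.
move: IH2 (gSS n) (g_ge0 n) (g_ge0 n.+1) (g_ge0 n.+2).
have -> : A ^+ n.+1 * (2 ^+ n.+1 * n.+1`!%:R) = 2 * n.+1%:R * A * P.
  by rewrite /P factS !exprS natrM; ring.
have -> : A ^+ n.+2 * (2 ^+ n.+2 * n.+2`!%:R) =
    4 * n.+1%:R * (n.+1%:R + 1) * A ^+ 2 * P.
  by rewrite /P !factS 4!exprS !natrM -[n.+2%:R]natr1; ring.
move: (g n) (g n.+1) (g n.+2) n.+1%:R m1 P P0 IH1.
move=> a b d m m1 P P0 aP bP dab a0 b0 d0.
(* The inequality (p + q)^2 <= 2 p^2 + 2 q^2 applied to the recurrence. *)
have step : d ^+ 2 <= 8 * c ^+ 2 * b ^+ 2 + 8 * m ^+ 2 * a ^+ 2.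
  apply: (@le_trans _ _ ((c * 2 * b + m * 2 * a) ^+ 2)).
    by rewrite ler_sqr ?nnegrE// addr_ge0// !mulr_ge0//; lra.
  rewrite -subr_ge0 (_ : _ - _ = (c * 2 * b - m * 2 * a) ^+ 2) ?sqr_ge0//.
  ring.
apply: (le_trans step).
(* The condition on c absorbs the first term; A >= 2 absorbs the second. *)
apply: (@le_trans _ _ (2 * A * (2 * m * A * P) + 8 * m ^+ 2 * P)).
  apply: lerD; last by rewrite ler_wpM2l// mulr_ge0// sqr_ge0.
  by apply: ler_pM; rewrite ?mulr_ge0 ?sqr_ge0//; lra.
rewrite -subr_ge0 (_ : _ - _ = m ^+ 2 * P * (4 * A ^+ 2 - 8)); last by ring.
by rewrite !mulr_ge0 ?sqr_ge0//; nra.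
Qed.

Lemma mehler_coef_growth (x y : R[i]) u du v dv (c A : R) n :
  hermite_rec x u du -> hermite_rec y v dv -> `|x| <= c%:C -> `|y| <= c%:C ->
  4 * c ^+ 2 <= A -> 2 <= A -> `|mehler_coef u v n| <= (A ^+ n)%:C.
Proof.
move=> ru rv xc yc cA A2.
have hu := hermite_rec_growth n ru xc cA A2.
have hv := hermite_rec_growth n rv yc cA A2.
have p_gt0 : 0 < 2 ^+ n * n`!%:R :> R.
  by rewrite mulr_gt0 ?exprn_gt0// ltr0n fact_gt0.
have An0 : 0 <= A ^+ n by rewrite exprn_ge0//; lra.
rewrite /mehler_coef normf_div normrM.
have -> : `|2 ^+ n * n`!%:R| = (2 ^+ n * n`!%:R : R)%:C.
  by rewrite -natrX -natrM normr_nat -(rmorph_nat (real_complex R)) natrM natrX.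
set p := 2 ^+ n * n`!%:R : R in p_gt0 hu hv *.
rewrite ler_pdivrMr ?ltcR// -[leRHS]rmorphM.
have Ap0 : 0 <= (A ^+ n * p)%:C by rewrite ler0c mulr_ge0// ltW.
rewrite -(@ler_pXn2r _ 2) ?nnegrE ?mulr_ge0//.
rewrite exprMn [leRHS]expr2.
by apply: ler_pM => //; rewrite exprn_ge0.
Qed.

End Growth.

(** * Convergence for small arguments *)

Section Limits.
Local Open Scope classical_set_scope.

Lemma cvg_partial_quotient (K : numFieldType) (a q : nat -> K) M (z l : K) :
  (fun N : nat => \sum_(0 <= n < N) z ^+ n * a n : K) @ \oo --> l ->
  (fun N : nat =>
     \sum_(0 <= n < N) z ^+ n * \sum_(j < M) shifted a n j * q j : K) @ \oo
    --> l * \sum_(j < M) z ^+ j * q j.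
Proof.
move=> cvg_a.
under eq_fun do rewrite sum_shifted.
rewrite mulrC mulr_suml.
have /= := @cvg_big K^o 'I_M +%R 0 xpredT (@add_continuous K^o) nat \oo
  (index_enum 'I_M)
  (fun j N => z ^+ j * q j * \sum_(0 <= n < N - j) z ^+ n * a n)
  (fun j => z ^+ j * q j * l) _; apply => j _.
apply: cvgMl_tmp.
rewrite (cvg_centern j (fun N => \sum_(0 <= n < N) z ^+ n * a n : K)).
exact: cvg_a.
Qed.

Variable R : realType.
Local Open Scope complex_scope.

Lemma normc_i : `|'i| = 1 :> R[i].
Proof. by rewrite normc_def expr0n expr1n add0r sqrtr1. Qed.

Lemma cvg_complex (u : nat -> R[i]) (a b : R) :
  (fun n : nat => complex.Re (u n)) @ \oo --> a ->
  (fun n : nat => complex.Im (u n)) @ \oo --> b ->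
  (fun n : nat => u n : R[i]^o) @ \oo --> (a +i* b : R[i]^o).
Proof.
move=> ua ub; apply/cvgrPdist_lt => e e0.
have eE : e = (complex.Re e)%:C by rewrite RRe_real// gtr0_real.
have Re0 : 0 < complex.Re e by rewrite -ltcR -eE.
have e2 : 0 < complex.Re e / 2 by rewrite divr_gt0.
move/cvgrPdist_lt/(_ _ e2) : ua; move/cvgrPdist_lt/(_ _ e2) : ub => ub ua.
near=> n.
rewrite eE [X in X%:C]splitr rmorphD /=.
rewrite [a +i* b - u n]complexE (le_lt_trans (ler_normD _ _))// normrM normc_i.
have norm_real (r : R) : `|r%:C| = `|r|%:C.
  by rewrite normc_def /= expr0n addr0 sqrtr_sqr.
rewrite mul1r !norm_real ltrD// ltcR.
  have -> : complex.Re (a +i* b - u n) = a - complex.Re (u n) by case: (u n).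
  by near: n; exact: ua.
have -> : complex.Im (a +i* b - u n) = b - complex.Im (u n) by case: (u n).
by near: n; exact: ub.
Unshelve. all: end_near. Qed.

Lemma normc_ge_Im (w : R[i]) : `|complex.Im w|%:C <= `|w|.
Proof.
by have := normc_ge_Re (w * 'i); rewrite ReiNIm normrN normrM normc_i mulr1.
Qed.

(** Convergence is checked on real and imaginary parts.  The ratio 1/4 leaves
    room for nonvanishing: the terms after the first add up to at most 1/3, so
    the real part of the sum stays above 1/2. *)
Lemma cvg_geometric_bound (c : nat -> R[i]) :
  c 0 = 1 -> (forall n : nat, `|c n| <= (4^-1 ^+ n)%:C) ->
  exists2 l : R[i], l != 0 &
   (fun N : nat => \sum_(0 <= n < N) c n : R[i]^o) @ \oo --> (l : R[i]^o).
Proof.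
move=> c0 cn.
have g1 : `|4^-1 : R| < 1 by rewrite ger0_norm; lra.
have cvg_part (f : R[i] -> R) : (forall w, `|f w| %:C <= `|w|) ->
  cvgn (series (f \o c)).
  move=> fb; apply: normed_cvg.
  apply: (@series_le_cvg _ _ (geometric 1 4^-1)) => [n|n|n|].
  - exact: normr_ge0.
  - by rewrite /geometric /= mul1r exprn_ge0.
  - by rewrite /geometric /= mul1r -lecR (le_trans (fb _)).
  - exact: is_cvg_geometric_series.
have ReP := cvg_part _ (@normc_ge_Re R).
have ImP := cvg_part _ normc_ge_Im.
(* The term in N is slack that makes the bound inductive. *)
have Re_gt N : 1 / 2 + 1 / 2 * 4^-1 ^+ N <= series (@complex.Re R \o c) N.+1.
  elim: N => [|N IH].
    by rewrite /series /= big_nat1 c0 /= expr0; lra.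
  rewrite seriesSr (le_trans _ (lerD IH (lexx _)))//=.
  have : `|complex.Re (c N.+1)| <= 4^-1 ^+ N.+1.
    by rewrite -lecR (le_trans (normc_ge_Re _)).
  rewrite ler_norml => /andP[+ _]; rewrite exprS.
  have : 0 <= 4^-1 ^+ N :> R by rewrite exprn_ge0.
  by move: (4^-1 ^+ N) (complex.Re _) => p r; lra.
have seriesE N : \sum_(0 <= n < N) c n =
    series (@complex.Re R \o c) N +i* series (@complex.Im R \o c) N.
  elim: N => [|N IH]; first by rewrite /series /= !big_nil.
  by rewrite big_nat_recr//= IH !seriesSr /=; case: (c N).
pose l :=
  limn (series (@complex.Re R \o c)) +i* limn (series (@complex.Im R \o c)).
exists l.
  apply: contraTneq isT => /(congr1 (@complex.Re R)) /= l0.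
  have : 1 / 2 <= limn (series (@complex.Re R \o c)).
    apply: limr_ge ReP _; exists 1%N => //= -[//|N] _ /=.
    rewrite (le_trans _ (Re_gt N))// lerDl mulr_ge0 ?exprn_ge0//; lra.
  by rewrite l0; lra.
apply: cvg_complex.
  by under eq_fun do rewrite seriesE.
by under eq_fun do rewrite seriesE.
Qed.
End Limits.

(** * Identification of the quotient *)

Section Quotient.
Variable R : realType.
Local Open Scope complex_scope.

Definition mehler_hermite (x y : R[i]) (n : nat) : R[i] :=
  mehler_coef (fun m : nat => (hermiteC R m).[x])
              (fun m : nat => (hermiteC R m).[y]) n.

(** The asserted value of the j-th quotient polynomial at (x, y); see
    [shifted_mehler_hermite] for the form with falling factorials. *)
Definition quotient_value (k : nat) (x y : R[i]) (j : nat) : R[i] :=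
  2 ^+ k * k`!%:R * quotient_coef (mehler_hermite x y) k j.

Lemma mehlerX_coefE k n (x y : R[i]) : n != k ->
  (hermiteX R k n).[x] * (hermiteX R k n).[y]
    / (2 ^+ n.+1 * n`!%:R * (n%:R - k%:R)) =
  \sum_(j < k.+2) shifted (mehler_hermite x y) n j * quotient_value k x y j.
Proof.
move=> nk; rewrite /hermiteX /wronskian !(hornerD, hornerN, hornerM).
rewrite (wronskian_conv k n (hermite_rec_hermiteC x) (hermite_rec_hermiteC y)).
rewrite -/(mehler_hermite x y).
under eq_bigr do rewrite /quotient_value mulrCA.
rewrite -mulr_sumr -/(conv_quotient _ _ _) -addSn exprD.
have f0 : n`!%:R != 0 :> R[i] by rewrite pnatr_eq0 -lt0n fact_gt0.
have e0 : 2 ^+ n.+1 != 0 :> R[i] by rewrite expf_neq0// pnatr_eq0.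
have nk0 : n%:R - k%:R != 0 :> R[i] by rewrite subr_eq0 eqr_nat.
move: (conv_quotient _ _ _) => c.
by field; rewrite f0 nk0 -?exprS e0.
Qed.

(** The term n = k is absent from E_(k); the convolution agrees with that
    omission. *)
Lemma mehlerX_coef_diag k (x y : R[i]) :
  \sum_(j < k.+2) shifted (mehler_hermite x y) k j * quotient_value k x y j = 0.
Proof.
under eq_bigr do rewrite /quotient_value mulrCA.
by rewrite -mulr_sumr -/(conv_quotient _ _ _) conv_quotient_diag mulr0.
Qed.

(** The bound r <= 1 / 2 keeps z inside the unit disc. *)
Lemma mehler_factorization k (x y : R[i]) : exists2 r : R, 0 < r <= 1 / 2 &
  forall z : R[i], `|z| <= r%:C -> mehler z x y != 0 /\
    mehlerX k z x y =
    mehler z x y * \sum_(j < k.+2) z ^+ j * quotient_value k x y j.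
Proof.
pose c : R := complex.Re `|x| + complex.Re `|y|.
have normE (w : R[i]) : `|w| = (complex.Re `|w|)%:C by rewrite normc_def.
have norm_ge0 (w : R[i]) : 0 <= complex.Re `|w| by rewrite -ler0c -normE.
have xc : `|x| <= c%:C by rewrite normE lecR lerDl.
have yc : `|y| <= c%:C by rewrite normE lecR lerDr.
pose A := 4 * c ^+ 2 + 2.
have A2 : 2 <= A by rewrite lerDr mulr_ge0// sqr_ge0.
have cA : 4 * c ^+ 2 <= A by rewrite lerDl.
have A_gt0 : 0 < A by lra.
have aA n : `|mehler_hermite x y n| <= (A ^+ n)%:C.
  exact: mehler_coef_growth (hermite_rec_hermiteC x) (hermite_rec_hermiteC y)
    xc yc cA A2.
(* For |z| <= 1 / (4 A), the bound A^n on the coefficients becomes 1 / 4^n. *)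
exists (4 * A)^-1.
  rewrite invr_gt0 mulr_gt0//= div1r lef_pV2 ?posrE//; lra.
move=> z zr.
have a0 : mehler_hermite x y 0 = 1.
  rewrite /mehler_hermite /mehler_coef hermiteC0 !hornerC expr0 fact0.
  by rewrite !mul1r invr1.
have za n : `|z ^+ n * mehler_hermite x y n| <= (4^-1 ^+ n)%:C.
  have -> : 4^-1 ^+ n = (4 * A)^-1 ^+ n * A ^+ n.
    by rewrite -exprMn invfM mulfVK// gt_eqF.
  rewrite normrM normrX rmorphM ler_pM ?exprn_ge0//.
  by rewrite rmorphXn lerXn2r ?nnegrE// (le_trans _ zr).
have [||l l0 cvg_l] :=
  @cvg_geometric_bound R (fun n => z ^+ n * mehler_hermite x y n).
- by rewrite expr0 mul1r.
- exact: za.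
have mehlerE : mehler z x y = l by apply: norm_cvg_lim cvg_l.
split; first by rewrite mehlerE.
rewrite mehlerE; apply: (@norm_cvg_lim R[i] R[i]^o).
have := @cvg_partial_quotient R[i] _ (quotient_value k x y) k.+2 _ _ cvg_l.
apply: cvg_trans; apply: near_eq_cvg; apply: nearW => N.
rewrite [RHS]big_mkcond; apply: eq_bigr => n _.
case: eqVneq => [->|nk]; first by rewrite mehlerX_coef_diag mulr0.
by rewrite mehlerX_coefE.
Qed.

Lemma poly_eq0_near0 (p : {poly R[i]}) (r : R) : 0 < r ->
  (forall t : R, 0 < t <= r -> p.[t%:C] = 0) -> p = 0.
Proof.
move=> r0 pt; apply/eqP; apply: contraT => p0.
pose s : seq R[i] := [seq (r / i.+1%:R)%:C | i <- iota 0 (size p)].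
have := @max_poly_roots _ p s p0; rewrite size_map size_iota ltnn; apply.
  apply/allP => _ /mapP[i _ ->]; apply/eqP/pt.
  by rewrite divr_gt0//= ler_pdivrMr// ler_peMr ?ler1n// ltW.
rewrite map_inj_uniq ?iota_uniq// => i j /complexI.
move=> /(mulfI (lt0r_neq0 r0)) /invr_inj /eqP.
by rewrite eqr_nat => /eqP[].
Qed.

(** The falling factorial appears as k! / (k - i)!, where (k - i)! is the
    denominator of a_(k-i). *)
Lemma shifted_mehler_hermite k i (x y : R[i]) : (i <= k)%N ->
  2 ^+ k * k`!%:R * shifted (mehler_hermite x y) k i =
  2 ^+ i * (k ^_ i)%:R
    * (hermiteC R (k - i)%N).[x] * (hermiteC R (k - i)%N).[y].
Proof.
move=> ik; rewrite /shifted ik /mehler_hermite /mehler_coef.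
rewrite -(ffact_fact ik) natrM -{1}(subnK ik) exprD.
have f0 : (k - i)`!%:R != 0 :> R[i] by rewrite pnatr_eq0 -lt0n fact_gt0.
have e0 : 2 ^+ (k - i) != 0 :> R[i] by rewrite expf_neq0// pnatr_eq0.
by field; rewrite f0 e0.
Qed.

End Quotient.

Theorem proposition3 (R : realType) (k : nat) (k_gt0 : (0 < k)%N)
    (Q : 'I_k.+2 -> {poly {poly R[i]}})
    (QE : forall z x y : R[i], `|z| < 1 ->
      mehlerX k z x y = mehler z x y * \sum_(n < k.+2) z ^+ n * (Q n).[x, y])
    (n : 'I_k.+2) (x y : R[i]) :
  (Q n).[x, y] =
    (1 <= n)%N%:R * (2 ^+ n.-1 * (k ^_ n.-1)%:R
      * (hermiteC R (k%:Z + 1 - n%:Z)).[x] * (hermiteC R (k%:Z + 1 - n%:Z)).[y])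
    - 2 ^+ n.+1 * (k ^_ n.+1)%:R
      * (hermiteC R (k%:Z - 1 - n%:Z)).[x] * (hermiteC R (k%:Z - 1 - n%:Z)).[y].
Proof.
have [r /andP[r0 r1] fact_r] := mehler_factorization k x y.
pose d (j : 'I_k.+2) := (Q j).[x, y] - quotient_value k x y j.
have p0 : \poly_(j < k.+2) d (inord j) = 0.
  apply: (poly_eq0_near0 r0) => t /andP[t0 tr].
  have nt : `|real_complex R t| = real_complex R t.
    by rewrite ger0_norm// ler0c ltW.
  have [|E0 EX] := fact_r (real_complex R t); first by rewrite nt lecR.
  have := QE (real_complex R t) x y.
  rewrite EX nt ltcR => /(_ _)/(mulfI E0) QEt.
  rewrite horner_poly.
  under eq_bigr do rewrite inord_val mulrBl ![_ * _ ^+ _]mulrC.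
  by rewrite sumrB -QEt ?subrr//; lra.
have -> : (Q n).[x, y] = quotient_value k x y n.
  apply/eqP; rewrite -subr_eq0; apply/eqP.
  by have := congr1 (coefp n) p0; rewrite /= coef_poly ltn_ord inord_val coef0.
rewrite /quotient_value /quotient_coef mulrBr; congr (_ - _).
  (* With n = i + 1, the index k + 1 - n is k - i. *)
  case: n {p0} => -[|i] /= ik; first by rewrite mul0r mulr0.
  rewrite shifted_mehler_hermite// mul1r.
  have -> : k%:Z + 1 - i.+1%:Z = (k - i)%N; last by [].
  by rewrite -subzn// intS; ring.
(* For n >= k the falling factorial vanishes, whatever the Hermite index. *)
case: (leqP n.+1 k) => nk; last first.
  by rewrite /shifted leqNgt nk ffact_small// mulr0n !mulr0 !mul0r.
rewrite shifted_mehler_hermite//.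
have -> : k%:Z - 1 - n%:Z = (k - n.+1)%N; last by [].
by rewrite -subzn// intS; ring.
Qed.
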